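(* Let $p,q$ be odd primes, $m=p+q$, $d\ge1$. If $p\ne q$ let $\mathcal{L}_{p,q}=\mathcal{P}_{d,p}\cup\mathcal{P}_{d,q}$; if $p=q$ let $\mathcal{L}_{p,q}=\mathcal{P}^{\mathbf{a},\epsilon'}_{d,p}\cup\mathcal{P}^{\mathbf{b},\epsilon''}_{d,p}$ with $\mathbf{a},\mathbf{b}\in\{1,\ldots,p-1\}^d$ and $\epsilon',\epsilon''\in\{0,1\}^{d-1}$. Assume $|\mathcal{L}_{p,q}|=p+q-1$. Then for every $\mathbf{k}\in([-p+1,p-1]^d\cap[-q+1,q-1]^d\cap\mathbb{Z}^d)\setminus\{0\}$, \[ \Big|\sum_{\mathbf{x}\in\mathcal{L}_{p,q}}\exp(2\pi\mathbf{i}\,\mathbf{k}\cdot\mathbf{x})\Big|\le (d-1)\sqrt{2m}+1. \]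
   Context: For a real $x\ge0$, $\{x\}$ denotes its fractional part; $\mathbb{Z}_p=\{0,\ldots,p-1\}$. For a prime $p$, $\mathbf{a}=(a_1,\ldots,a_d)$ and $\epsilon\in\{0,1\}^{d-1}$, put $a_h'=\epsilon_h a_h$ and for $j\in\mathbb{Z}_p$ let $\mathbf{x}^{\mathbf{a},\epsilon}_j\in[0,1)^d$ be the point whose $i$-th coordinate ($1\le i\le d$) is $\{(\sum_{h=1}^{i-1}a_h'j^h+a_ij^i)/p\}$; $\mathcal{P}^{\mathbf{a},\epsilon}_{d,p}=\{\mathbf{x}^{\mathbf{a},\epsilon}_j:j\in\mathbb{Z}_p\}$. The classical $p$-set $\mathcal{P}_{d,p}$ is the case $\mathbf{a}=(1,\ldots,1)$, $\epsilon=(0,\ldots,0)$, i.e. $\{(\{j/p\},\{j^2/p\},\ldots,\{j^d/p\}):j\in\mathbb{Z}_p\}$. Sums over a set count each distinct point once. *)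

(* Defs.v *)
From HB Require Import structures.
From mathcomp Require Import all_boot all_order all_algebra.
From mathcomp Require Import finmap complex.
From mathcomp Require Import all_classical all_reals all_analysis.

Set Implicit Arguments.
Unset Strict Implicit.
Unset Printing Implicit Defensive.

Import Order.TTheory GRing.Theory Num.Theory.

Local Open Scope fset_scope.
Local Open Scope complex_scope.
Local Open Scope ring_scope.

Definition fracpart (R : realType) (x : R) : R := x - (Num.floor x)%:~R.

Definition cexp (R : realType) (z : R[i]) : R[i] :=
  (expR (complex.Re z))%:C *
  (cos (complex.Im z) +i* sin (complex.Im z)).

Definition dotp (R : realType) (d : nat) (k : 'rV[int]_d) (x : 'rV[R]_d) : R :=
  \sum_(i < d) (k 0 i)%:~R * x 0 i.

(* Indices start at 0: the ordinal i stands for the index i + 1 of the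
   mathematical text, hence the exponents i.+1; the bits eps h are read as
   the natural numbers 0 and 1. *)
Definition pexponent (d : nat) (a : 'I_d -> nat) (eps : 'I_d.-1 -> bool)
    (j : nat) (i : 'I_d) : nat :=
  (\sum_(h < d.-1 | (h < i)%N)
      eps h * a (widen_ord (leq_pred d) h) * j ^ h.+1
   + a i * j ^ i.+1)%N.

Definition ppoint_ae (R : realType) (d p : nat) (a : 'I_d -> nat)
    (eps : 'I_d.-1 -> bool) (j : nat) : 'rV[R]_d :=
  \row_(i < d) fracpart ((pexponent a eps j i)%:R / p%:R).

Definition pset_ae (R : realType) (d p : nat) (a : 'I_d -> nat)
    (eps : 'I_d.-1 -> bool) : {fset 'rV[R]_d} :=
  [fset ppoint_ae R p a eps j | j : 'I_p in 'I_p].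

Definition classical_pset (R : realType) (d p : nat) : {fset 'rV[R]_d} :=
  pset_ae R p (fun _ : 'I_d => 1%N) (fun _ : 'I_d.-1 => false).

Lemma classical_psetE (R : realType) (d p : nat) :
  classical_pset R d p =
  [fset \row_(i < d) fracpart ((j ^ i.+1)%N%:R / p%:R : R) | j : 'I_p in 'I_p].
Proof.
rewrite /classical_pset /pset_ae; apply: eq_imfset => [j|j] /=; last by [].
by apply/rowP => i; rewrite !mxE /pexponent big1 ?add0n ?mul1n.
Qed.

(* Main.v *)
(** The proof rests on Weil's bound |sum_x psi(f(x))| <= (deg f - 1) sqrt q for
    a nontrivial additive character psi of a finite field F with q elements and
    deg f prime to q.

    Let S_n be the same sum over the extension of degree n (psi composed with the
    trace).  The L-function sum_G lam(G) X^(deg G), over monic polynomials G with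
    lam(G) = psi(sum of f over the roots of G), is a polynomial of degree < deg f,
    because for deg G >= deg f Newton's identities make the sum of f over the roots
    affine and nonconstant in one coefficient of G.  Its logarithmic derivative is
    the generating series of the S_n, whence S_n = - sum_(i < deg f - 1) om_i^n.
    Stepanov's method bounds each fibre of the trace of f, hence S_(2 m) = O(q^m);
    as the power sums of the om_i^2 dominate the largest of them, |om_i|^2 <= q.

    An index j of a p-set contributes exp(2 i pi g(j) / p), where g is a
    polynomial whose degree is one of the exponents 1, ..., d, so each of the two
    p-sets contributes at most (d - 1) sqrt p (trivially so when deg g >= p).  The
    cardinality hypothesis says that the two sets share exactly one point, and
    sqrt p + sqrt q <= sqrt (2 (p + q)). *)

Require Import Defs.
From HB Require Import structures.
From mathcomp Require Import all_boot all_order all_algebra all_field.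
From mathcomp Require Import finmap complex.
From mathcomp Require Import all_classical all_reals all_analysis.
From mathcomp Require Import ring lra zify.

Set Implicit Arguments.
Unset Strict Implicit.
Unset Printing Implicit Defensive.

Import Order.TTheory GRing.Theory Num.Theory.

Local Open Scope ring_scope.

(** * Newton's identities *)

Section Newton.
Variable R : comNzRingType.

Definition psum (rs : seq R) (m : nat) : R := \sum_(r <- rs) r ^+ m.

(** The reversal of the monic polynomial with roots [rs]: its coefficients are the signed elementary
    symmetric functions, so Newton's identities carry no alternating signs. *)
Definition eprod (rs : seq R) : {poly R} := \prod_(r <- rs) (1 - r *: 'X).

Lemma coef_eprod_cons (r : R) (rs : seq R) (m : nat) :
  (eprod (r :: rs))`_m = (eprod rs)`_m - (if m is i.+1 then r * (eprod rs)`_i else 0).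
Proof.
rewrite /eprod big_cons mulrBl mul1r coefB -scalerAl coefZ coefXM.
by case: m => [|m] /=; rewrite ?mulr0.
Qed.

Lemma eprod0 (rs : seq R) : (eprod rs)`_0 = 1.
Proof.
elim: rs => [|r rs IH]; first by rewrite /eprod big_nil coefC.
by rewrite coef_eprod_cons IH subr0.
Qed.

(** Induction on the list: a new root [r] multiplies [eprod] by [1 - r *: 'X], and the terms in
    powers of [r] telescope. No relation between [m] and the number of roots is assumed. *)
Lemma newton_identity (rs : seq R) (m : nat) :
  \sum_(i < m) (eprod rs)`_i * psum rs (m - i) + m%:R * (eprod rs)`_m = 0.
Proof.
elim: rs m => [|r rs IH] m.
  rewrite big1 ?add0r; last by move=> i _; rewrite /psum big_nil mulr0.
  by rewrite /eprod big_nil coefC; case: m => [|m]; rewrite ?mul0r ?mulr0.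
case: m => [|m]; first by rewrite big_ord0 mul0r addr0.
set e := fun i => (eprod rs)`_i.
have tele : \sum_(i < m.+1) e i * r ^+ (m.+1 - i)
   - \sum_(i < m) r * e i * r ^+ (m - i) = r * e m.
  rewrite big_ord_recr /= subSnn expr1.
  rewrite -[X in X + _ - _](_ : \sum_(i < m) r * e i * r ^+ (m - i) = _).
    by ring.
  by apply: eq_bigr => i _; rewrite subSn ?exprS; [ring | exact: ltnW].
have IH1 := IH m.+1; have IH2 := IH m.
have psc j : psum (r :: rs) j = r ^+ j + psum rs j by rewrite /psum big_cons.
rewrite coef_eprod_cons.
have -> : \sum_(i < m.+1) (eprod (r :: rs))`_i * psum (r :: rs) (m.+1 - i) =
  \sum_(i < m.+1) e i * psum rs (m.+1 - i) + (\sum_(i < m.+1) e i * r ^+ (m.+1 - i)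
  - \sum_(i < m) r * e i * r ^+ (m - i)) - r * \sum_(i < m) e i * psum rs (m - i).
  have rl (f : nat -> R) : \sum_(i < m.+1) f i = f 0%N + \sum_(i < m) f i.+1.
    by rewrite big_ord_recl.
  rewrite (rl (fun i => (eprod (r :: rs))`_i * psum (r :: rs) (m.+1 - i))).
  rewrite (rl (fun i => e i * psum rs (m.+1 - i))) (rl (fun i => e i * r ^+ (m.+1 - i))).
  have -> : \sum_(i < m) (eprod (r :: rs))`_i.+1 * psum (r :: rs) (m.+1 - i.+1) =
     \sum_(i < m) e i.+1 * psum rs (m.+1 - i.+1)
     + \sum_(i < m) e i.+1 * r ^+ (m.+1 - i.+1)
     - \sum_(i < m) r * e i * r ^+ (m - i) - r * \sum_(i < m) e i * psum rs (m - i).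
    rewrite mulr_sumr -big_split -!sumrB /=; apply: eq_bigr => i _.
    by rewrite coef_eprod_cons psc subSS /e; ring.
  by rewrite coef_eprod_cons psc subr0 /e; ring.
rewrite tele; move: IH1 IH2; rewrite -/(e m) -/(e m.+1).
rewrite -[\sum_(i < m.+1) _]/(\sum_(i < m.+1) e i * psum rs (m.+1 - i)).
rewrite -[X in X + m%:R * _]/(\sum_(i < m) e i * psum rs (m - i)) -natr1.
move/eqP; rewrite addr_eq0 => /eqP ->; move/eqP; rewrite addr_eq0 => /eqP ->; ring.
Qed.

Lemma size_eprod_leq (rs : seq R) : (size (eprod rs) <= (size rs).+1)%N.
Proof.
elim: rs => [|r rs IH]; first by rewrite /eprod big_nil size_poly1.
apply/leq_sizeP => -[//|j] lt_j; rewrite coef_eprod_cons.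
by rewrite !nth_default ?mulr0 ?subr0 ?(leq_trans IH) // ltnW.
Qed.

Lemma coef_prod_XsubC_eprod (rs : seq R) (i : nat) : (i <= size rs)%N ->
  (\prod_(r <- rs) ('X - r%:P))`_(size rs - i) = (eprod rs)`_i.
Proof.
elim: rs i => [|r rs IH] i; first by rewrite leqn0 => /eqP ->; rewrite /eprod !big_nil.
have sz : size (\prod_(r <- rs) ('X - r%:P)) = (size rs).+1 by rewrite size_prod_XsubC.
rewrite [size _]/= coef_eprod_cons big_cons mulrBl coefB coefCM coefXM.
case: i => [|i] le_i.
  by rewrite subn0 /= -{1}(subn0 (size rs)) IH // [X in _ * X]nth_default ?sz // mulr0.
rewrite subSS IH //; congr (_ - _); case: eqP => [/eqP|/eqP nz].
  rewrite subn_eq0 => le_sz; rewrite nth_default //.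
  exact: leq_trans (size_eprod_leq rs) _.
have lt_i : (i < size rs)%N by rewrite -subn_gt0 lt0n.
by rewrite -subnS IH.
Qed.
End Newton.

(** * Growth of power sums *)

Lemma bernoulli_ineq (C : numDomainType) (x : C) (n : nat) :
  0 <= x -> 1 + n%:R * x <= (1 + x) ^+ n.
Proof.
move=> x_ge0; elim: n => [|n IH]; first by rewrite mul0r addr0.
apply: (@le_trans _ _ ((1 + x) * (1 + n%:R * x))); last first.
  by rewrite exprS ler_wpM2l // addr_ge0.
rewrite -subr_ge0 -natr1 [X in 0 <= X](_ : _ = n%:R * x ^+ 2); last by ring.
by rewrite mulr_ge0 ?ler0n ?exprn_ge0.
Qed.

(** With [L] the generating series of [a], the recurrence says that [X L' / L] is the generating
    series of the [S n]. Factoring [L] into terms [1 - z X] turns the [S n] into minus the power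
    sums of the [z]. *)
Lemma exists_power_sums (C : closedFieldType) (d : nat) (a S : nat -> C) :
  (0 < d)%N -> a 0 = 1 -> (forall k, (d <= k)%N -> a k = 0) ->
  (forall n, n%:R * a n = \sum_(i < n) a i * S (n - i)%N) ->
  exists2 zs : seq C, size zs = d.-1 & forall n, (0 < n)%N -> S n = - psum zs n.
Proof.
case: d => // d _ a0 a_high aS.
(* The reversed series, with [d] now lowered by one. It is monic of degree exactly [d] because
   [a 0 = 1]; a series of lower degree only contributes zero roots. *)
pose P := \poly_(i < d.+1) a (d - i)%N.
have szP : size P = d.+1 by rewrite size_poly_eq //= subnn a0 oner_eq0.
have [zs] := closed_field_poly_normal P.
rewrite /lead_coef szP /= coef_poly ltnSn subnn a0 scale1r => PE.
have szzs : size zs = d by move: szP; rewrite PE size_prod_XsubC => -[].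
exists zs => //.
have eE i : (eprod zs)`_i = a i.
  have [le_i|lt_i] := leqP i d; last first.
    by rewrite a_high // nth_default // (leq_trans (size_eprod_leq _)) ?szzs.
  by rewrite -coef_prod_XsubC_eprod ?szzs // -PE coef_poly ltnS leq_subr subKn.
elim/ltn_ind => -[//|n] IH _.
have := newton_identity zs n.+1; rewrite eE aS -big_split big_ord_recl big1 => [|i _].
  by rewrite /= eE a0 !mul1r subn0 addr0 addrC => /eqP; rewrite addr_eq0 => /eqP.
rewrite /= eE IH; last 2 first.
- by rewrite /bump /=; lia.
- by rewrite subn_gt0; case: i.
by rewrite mulrN subrr.
Qed.

Lemma power_sum_growth (C : numFieldType) (nu : seq C) (c B : C) (n0 : nat) :
  (forall x : C, exists n : nat, `|x| <= n%:R) -> 0 < B ->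
  (forall n, (n0 <= n)%N -> `|psum nu n| <= c * B ^+ n) ->
  forall v, v \in nu -> `|v| <= B.
Proof.
move=> archi B_gt0 bound v v_nu.
rewrite real_leNgt ?normr_real ?gtr0_real //; apply/negP => lt_Bv.
(* Combining shifted power sums with the coefficients of P isolates the powers of v. *)
pose P := \prod_(w <- [seq w <- undup nu | w != v]) ('X - w%:P).
have Pv : P.[v] != 0.
  rewrite -rootE root_prod_XsubC mem_filter eqxx //.
have Pw w : w \in nu -> w != v -> P.[w] = 0.
  by move=> ? ?; apply/eqP; rewrite -rootE root_prod_XsubC mem_filter mem_undup; apply/andP.
(* In characteristic zero a positive multiplicity cannot cancel the contribution of [v]. *)
pose m := count_mem v nu; have m_gt0 : (0 < m)%N by rewrite -has_count has_pred1.
have sumE n : \sum_(w <- nu) P.[w] * w ^+ n = m%:R * P.[v] * v ^+ n.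
  rewrite (bigID (pred1 v)) /= [X in _ + X]big1_seq ?addr0; last first.
    by move=> w /andP[wv w_nu]; rewrite Pw ?mul0r.
  rewrite (eq_bigr (fun=> P.[v] * v ^+ n)) => [|w /eqP -> //].
  by rewrite big_const_seq iter_addr_0 -mulrA mulr_natl.
have sumP n : \sum_(w <- nu) P.[w] * w ^+ n = \sum_(j < size P) P`_j * psum nu (n + j).
  under eq_bigr => w _ do rewrite horner_coef mulr_suml.
  rewrite exchange_big; apply: eq_bigr => j _ /=; rewrite mulr_sumr.
  by apply: eq_bigr => w _; rewrite exprD; ring.
pose M := \sum_(j < size P) `|P`_j| * (c * B ^+ j).
have vM n : (n0 <= n)%N -> `|m%:R * P.[v]| * (`|v| / B) ^+ n <= M.
  move=> le_n; rewrite expr_div_n mulrA ler_pdivrMr ?exprn_gt0 //.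
  rewrite -normrX -normrM -sumE sumP (le_trans (ler_norm_sum _ _ _)) //.
  rewrite /M mulr_suml; apply: ler_sum => j _; rewrite normrM -mulrA ler_wpM2l //.
  by rewrite -mulrA -exprD (addnC j) bound // (leq_trans le_n) ?leq_addr.
set k := `|_| in vM; have k_gt0 : 0 < k.
  by rewrite normr_gt0 mulf_neq0 // pnatr_eq0 -lt0n.
(* By Bernoulli's inequality the powers of [1 + x] grow at least linearly, against the fixed bound
   [M / k]. *)
pose x := `|v| / B - 1; have x_gt0 : 0 < x.
  by rewrite subr_gt0 ltr_pdivlMr ?mul1r.
have [N ltN] := archi (M / k / x).
have := vM (maxn n0 N.+1) (leq_maxl _ _).
rewrite -(subrK 1 (`|v| / B)) -/x addrC -ler_pdivlMl // mulrC => le1.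
have le2 := le_trans (bernoulli_ineq (maxn n0 N.+1) (ltW x_gt0)) le1.
have : N.+1%:R * x <= M / k.
  apply: le_trans le2; rewrite -[X in X <= _]add0r lerD ?ler01 // ler_wpM2r //; first exact: ltW.
  by rewrite ler_nat leq_maxr.
rewrite -ler_pdivlMr // => le3.
have M_ge0 : 0 <= M.
  by apply: le_trans (vM n0 (leqnn _)); rewrite mulr_ge0 ?exprn_ge0 ?divr_ge0 ?normr_ge0 ?ltW.
have Mkx_ge0 : 0 <= M / k / x by rewrite !divr_ge0 // ltW.
rewrite ger0_norm // in ltN.
by have := le_trans le3 ltN; rewrite ler_nat ltnn.
Qed.

(** * Orbits of the Frobenius *)

Lemma sum_nat_of_bool (I : Type) (r : seq I) (P : pred I) :
  (\sum_(i <- r) P i)%N = count P r.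
Proof. by elim: r => [|i r IH]; rewrite ?big_nil ?big_cons //= IH. Qed.

Lemma sum_count_mem (T : eqType) (t rs : seq T) :
  uniq t -> (\sum_(y <- t) count_mem y rs)%N = count [in t] rs.
Proof.
move=> t_uniq; rewrite -sum_nat_of_bool.
under eq_bigr => y _ do rewrite -sum_nat_of_bool.
rewrite exchange_big /=; apply: eq_bigr => r _.
rewrite -count_uniq_mem // -sum_nat_of_bool; apply: eq_bigr => y _.
by rewrite /= eq_sym.
Qed.

Section FrobeniusOrbits.
Variables (T : eqType) (s : T -> T).
Hypothesis s_inj : injective s.
Implicit Types (x : T) (rs : seq T).

(** Stability as a multiset, the property of the root list of a polynomial whose coefficients are
    fixed by [s]. *)
Definition stable_seq rs := perm_eq (map s rs) rs.

Lemma count_mem_iter rs x i : stable_seq rs ->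
  count_mem (iter i s x) rs = count_mem x rs.
Proof.
move=> st; elim: i => [//|i <-] /=; rewrite -(seq.permP st) count_map.
by apply: eq_count => y /=; rewrite (inj_eq s_inj).
Qed.

Lemma stable_traject x j : iter j s x = x -> stable_seq (traject s x j).
Proof.
case: j => [|j] fix_x; first by [].
have map_traject n y : map s (traject s y n) = traject s (s y) n.
  by elim: n y => [//|n IH] y /=; rewrite IH.
rewrite /stable_seq map_traject trajectSr -[iter j s (s x)]iterSr fix_x.
by rewrite perm_rcons.
Qed.

(** Pigeonhole: the iterates of [x] stay in [rs], so two of them coincide, and injectivity of [s]
    cancels the common iterations. *)
Lemma stable_period rs x : stable_seq rs -> x \in rs ->
  exists2 o, (0 < o)%N & iter o s x = x.
Proof.
move=> st x_rs.
have all_rs i : iter i s x \in rs.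
  by rewrite -has_pred1 has_count count_mem_iter // -has_count has_pred1.
have: ~~ uniq (traject s x (size rs).+1).
  apply/negP => /uniq_leq_size le_sz.
  suff /le_sz : {subset traject s x (size rs).+1 <= rs} by rewrite size_traject ltnn.
  by move=> y /trajectP[i _ ->].
rewrite looping_uniq negbK => /trajectP[i lt_i].
rewrite -(subnK (ltnW lt_i)) addnC iterD => E.
exists (size rs - i)%N; first by rewrite subn_gt0.
have iter_inj k : injective (iter k s).
  by elim: k => [|k IH] a b //= /s_inj/IH.
exact: iter_inj E.
Qed.

(* With o the least period of x, the j counted are exactly o, 2 o, ..., mu o,
   where mu is the multiplicity of x in rs. *)
Lemma count_period_multiplicity rs x : stable_seq rs ->
  count (fun j => (iter j s x == x) &&
                  (count_mem x (traject s x j) <= count_mem x rs))%N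
        (iota 1 (size rs)) = count_mem x rs.
Proof.
move=> st; set mu := count_mem x rs.
have [mu0|mu_gt0] := posnP mu.
  rewrite mu0; apply/eqP; rewrite eqn0Ngt -has_count; apply/hasPn => j.
  by rewrite mem_iota => /andP[j_gt0 _]; rewrite -(prednK j_gt0) /= eqxx andbF.
have x_rs : x \in rs by rewrite -has_pred1 has_count.
have [per per_gt0 fix_per] := stable_period st x_rs.
have ex_o : exists o, (0 < o)%N && (iter o s x == x).
  by exists per; rewrite per_gt0 fix_per eqxx.
case: (ex_minnP ex_o) => o /andP[gt0_o /eqP fix_o] o_min.
have fix_mul i : iter (i * o) s x = x.
  by elim: i => [//|i IH]; rewrite mulSn iterD IH.
have periodE j : (iter j s x == x) = (o %| j)%N.
  apply/eqP/dvdnP => [|[i ->]]; last exact: fix_mul.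
  rewrite {1}(divn_eq j o) addnC iterD fix_mul => fix_r.
  exists (j %/ o)%N; rewrite {1}(divn_eq j o).
  have [->|r_gt0] := posnP (j %% o); first by rewrite addn0.
  by have := o_min (j %% o)%N; rewrite r_gt0 fix_r eqxx leqNgt ltn_pmod // => /(_ isT).
have notin_tail : x \notin traject s (s x) o.-1.
  apply/trajectP => -[i lt_i]; rewrite -iterSr => /esym fix_i.
  by have := o_min i.+1; rewrite fix_i eqxx => /(_ isT); lia.
have count_traject i : count_mem x (traject s x (i * o)) = i.
  elim: i => [//|i IH]; rewrite mulSn trajectD count_cat fix_o IH -(prednK gt0_o) /= eqxx.
  by rewrite (count_memPn notin_tail) addn0 add1n.
have uniq_orbit : uniq (traject s x o).
  rewrite -(prednK gt0_o) looping_uniq; apply/trajectP => -[i lt_i E].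
  have /eqP := E; rewrite -{1}(subnK (ltnW lt_i)) addnC iterD; move/eqP.
  have iter_inj k : injective (iter k s).
    by elim: k => [|k IH] a b //= /s_inj/IH.
  move/iter_inj => fix_i.
  by have := o_min (o.-1 - i)%N; rewrite fix_i eqxx subn_gt0 lt_i => /(_ isT); lia.
(* Every point of the orbit has multiplicity [mu] in [rs]. The bound puts [o], ..., [mu * o] inside
   the range [iota 1 (size rs)]. *)
have le_mu : (mu * o <= size rs)%N.
  apply: leq_trans (count_size [in traject s x o] rs).
  rewrite -sum_count_mem // big_seq (eq_bigr (fun=> mu)) => [|y /trajectP[i _ ->]].
    by rewrite -big_seq big_const_seq count_predT size_traject iter_addn_0.
  exact: count_mem_iter.
rewrite -[RHS](size_iota 1) -[RHS](size_map (muln^~ o)) -size_filter.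
apply: perm_size; apply: uniq_perm.
- exact: filter_uniq (iota_uniq _ _).
- by rewrite map_inj_uniq ?iota_uniq // => i j /eqP; rewrite eqn_pmul2r // => /eqP.
move=> j; rewrite mem_filter periodE mem_iota.
apply/andP/mapP => [[/andP[/dvdnP[i ->]]]|[l]].
  rewrite count_traject => le_i /andP[gt0 _]; exists i => //.
  by rewrite mem_iota; case: i gt0 le_i.
rewrite mem_iota add1n ltnS => /andP[l_gt0 le_l] ->.
rewrite dvdn_mull // count_traject; split=> //.
by rewrite muln_gt0 l_gt0 gt0_o add1n ltnS (leq_trans _ le_mu) // leq_mul2r le_l orbT.
Qed.

End FrobeniusOrbits.

(** * Polynomials attached to Frobenius orbits *)

Section OrbitPolynomials.
Variables (K : fieldType) (s : {rmorphism K -> K}).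

Lemma dvdp_prod_XsubC (t rs : seq K) :
  (forall y, count_mem y t <= count_mem y rs)%N ->
  \prod_(y <- t) ('X - y%:P) %| \prod_(y <- rs) ('X - y%:P).
Proof.
elim: t rs => [|y t IH] rs le_t; first by rewrite big_nil dvd1p.
have y_rs : y \in rs by rewrite -has_pred1 has_count (leq_trans _ (le_t y)) //= eqxx.
rewrite (perm_big _ (perm_to_rem y_rs)) !big_cons dvdp_mul2l ?polyXsubC_eq0 //.
apply: IH => z; have := le_t z; rewrite (seq.permP (perm_to_rem y_rs)) /=.
by rewrite leq_add2l.
Qed.

(** When [iter j s x = x] the trajectory may wind round the orbit several times; the product is then
    a power of the minimal polynomial of [x] over the fixed field of [s]. *)
Definition orbit_poly (j : nat) (x : K) : {poly K} :=
  \prod_(y <- traject s x j) ('X - y%:P).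

(** Multiplicities are constant along the orbit, in the trajectory as in [rs], so divisibility need
    only be tested at [x]. *)
Lemma dvdp_orbit_poly (rs : seq K) (x : K) (j : nat) :
  stable_seq s rs -> iter j s x = x ->
  (orbit_poly j x %| \prod_(y <- rs) ('X - y%:P))
    = (count_mem x (traject s x j) <= count_mem x rs)%N.
Proof.
move=> st fix_x; have s_inj : injective s := fmorph_inj s.
have nz (t : seq K) : \prod_(y <- t) ('X - y%:P) != 0.
  by rewrite monic_neq0 // monic_prod_XsubC.
apply/idP/idP => [dv|le_x].
  rewrite -(mu_prod_XsubC x rs) mup_geq //; apply: dvdp_trans dv.
  by rewrite -mup_geq ?nz // /orbit_poly mu_prod_XsubC.
apply: dvdp_prod_XsubC => y.
have [y_t|/count_memPn -> //] := boolP (y \in traject s x j).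
have /trajectP[i _ ->] := y_t.
by rewrite !count_mem_iter //; exact: stable_traject.
Qed.

(** Each distinct root is counted as often as its multiplicity, by [count_period_multiplicity], and
    the multiplicities add up to the degree. This is the combinatorial content of the logarithmic
    derivative of the Euler product. *)
Lemma sum_dvdp_orbit_poly (E : nat -> seq K) (rs : seq K) :
  (forall n, uniq (E n)) -> (forall n x, (0 < n)%N -> (x \in E n) = (iter n s x == x)) ->
  stable_seq s rs ->
  (\sum_(1 <= j < (size rs).+1) \sum_(x <- E j)
     (orbit_poly j x %| \prod_(y <- rs) ('X - y%:P))%R)%N = size rs.
Proof.
move=> E_uniq mem_E st; set G := \prod_(y <- rs) _.
transitivity (\sum_(1 <= j < (size rs).+1) \sum_(x <- undup rs)
   ((iter j s x == x) && (count_mem x (traject s x j) <= count_mem x rs)))%N.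
  apply: eq_big_nat => -[//|j] _.
  rewrite !sum_nat_of_bool -!size_filter; apply/perm_size/uniq_perm.
  - exact: filter_uniq.
  - exact/filter_uniq/undup_uniq.
  move=> x; rewrite !mem_filter mem_E // mem_undup.
  case: eqP => [fix_x|_]; last by rewrite andbF.
  rewrite andbT andTb dvdp_orbit_poly //; case: leqP => //= le_x.
  by rewrite -has_pred1 has_count (leq_trans _ le_x) //= eqxx.
rewrite exchange_big /=.
under eq_bigr => x _.
  rewrite sum_nat_of_bool /index_iota subSS subn0 count_period_multiplicity; last 2 first.
  - exact: fmorph_inj.
  - by [].
  over.
rewrite sum_count_mem ?undup_uniq //.
by apply/eqP; rewrite -all_count; apply/allP => x /=; rewrite mem_undup.
Qed.
End OrbitPolynomials.

(** * Finite fields inside an algebraically closed field *)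

(** Newton's identities express each power sum through earlier ones and the coefficients; the
    changed coefficient first enters at index [d], in the term with factor [d%:R]. *)
Lemma psum_newton_perturb (R : comNzRingType) (rs rs' : seq R) (d : nat) (c : R) :
  (0 < d)%N ->
  (forall i, (i < d)%N -> (eprod rs')`_i = (eprod rs)`_i) ->
  (eprod rs')`_d = (eprod rs)`_d + c ->
  (forall m, (0 < m < d)%N -> psum rs' m = psum rs m) /\
  psum rs' d = psum rs d - d%:R * c.
Proof.
move=> d_gt0 e_eq e_d.
have psumE t m : (0 < m)%N -> psum t m =
    - (\sum_(1 <= i < m) (eprod t)`_i * psum t (m - i)) - m%:R * (eprod t)`_m.
  case: m => // m _; have := newton_identity t m.+1.
  rewrite -(big_mkord xpredT (fun i => (eprod t)`_i * psum t (m.+1 - i))).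
  rewrite big_ltn // eprod0 mul1r subn0 -addrA => /eqP.
  by rewrite addr_eq0 opprD => /eqP.
have low m : (0 < m < d)%N -> psum rs' m = psum rs m.
  elim/ltn_ind: m => m IH /andP[m_gt0 lt_md].
  rewrite !psumE // e_eq //; congr (- _ - _).
  apply: eq_big_nat => i /andP[i_gt0 lt_im]; rewrite e_eq ?IH //; lia.
split=> //; rewrite !psumE // e_d mulrDr opprD addrA; congr (- _ - _ - _).
apply: eq_big_nat => i /andP[i_gt0 lt_id]; rewrite e_eq ?low //; lia.
Qed.

Section Frobenius.
Variables (F : finFieldType) (K : fieldType) (iota : {rmorphism F -> K}).

Lemma card_pchar_pow : exists2 p, p \in [pchar F] & exists k, #|F| = (p ^ k)%N.
Proof.
have [p _ pchF] := finPcharP F; exists p => //.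
by exists (logn p #|F|); exact: (card_pprimeChar pchF).
Qed.

Lemma frobenius_rmorphism : exists s : {rmorphism K -> K}, forall x, s x = x ^+ #|F|.
Proof.
have [p pchF [k ->]] := card_pchar_pow.
have pchK : p \in [pchar K] by rewrite (fmorph_pchar iota).
elim: k => [|k [s sE]]; first by exists idfun => x; rewrite expn0 expr1.
exists (pFrobenius_aut pchK \o s) => x /=.
by rewrite pFrobenius_autE sE -exprM expnSr.
Qed.

Lemma card_natr0 : #|F|%:R = 0 :> K.
Proof.
have [p pchF [k qE]] := card_pchar_pow.
have pchK : p \in [pchar K] by rewrite (fmorph_pchar iota).
apply/eqP; rewrite -(dvdn_pcharf pchK) qE dvdn_exp //.
case: k qE => // /eqP; rewrite expn0; have := finNzRing_gt1 F; by case: #|F| => [|[]].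
Qed.

Variables (s : {rmorphism K -> K}).
Hypothesis sE : forall x, s x = x ^+ #|F|.

Lemma iter_frobenius n x : iter n s x = x ^+ (#|F| ^ n).
Proof. by elim: n => [|n IH] //=; rewrite sE IH -exprM expnSr. Qed.

Lemma frobenius_iota c : s (iota c) = iota c.
Proof. by rewrite sE -rmorphXn /= expf_card. Qed.

Lemma frobenius_fixed x : s x = x -> exists c, iota c = x.
Proof.
rewrite sE => fix_x.
have: root (map_poly iota ('X^#|F| - 'X)) x.
  by rewrite rmorphB /= map_polyXn map_polyX /root !hornerE fix_x subrr.
rewrite finField_genPoly map_prod_XsubC -(big_map iota xpredT (fun y => 'X - y%:P)).
by rewrite root_prod_XsubC => /mapP[c _ ->]; exists c.
Qed.

Lemma frobenius_poly_fixed (g : {poly F}) : map_poly s (map_poly iota g) = map_poly iota g.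
Proof. by apply/polyP => i; rewrite !coef_map /= frobenius_iota. Qed.

Lemma horner_iter_frobenius (g : {poly F}) n x :
  (map_poly iota g).[iter n s x] = iter n s (map_poly iota g).[x].
Proof.
elim: n => //= n <-; by rewrite -horner_map frobenius_poly_fixed.
Qed.

End Frobenius.

Section FiniteSubfields.
Variables (F : finFieldType) (K : closedFieldType) (iota : {rmorphism F -> K}).
Variables (s : {rmorphism K -> K}).
Hypothesis sE : forall x, s x = x ^+ #|F|.

Lemma subfield_roots (n : nat) (E : seq K) (P : {poly K} := 'X^(#|F| ^ n) - 'X) :
  (0 < n)%N -> P = lead_coef P *: \prod_(x <- E) ('X - x%:P) ->
  [/\ uniq E, forall x, (x \in E) = (iter n s x == x) & size E = (#|F| ^ n)%N].
Proof.
move=> n_gt0; set N := (#|F| ^ n)%N in P *.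
have N_gt1 : (1 < N)%N by rewrite -(exp1n n) ltn_exp2r // finNzRing_gt1.
have szP : size P = N.+1 by rewrite size_polyDl ?size_polyXn // size_polyN size_polyX.
have -> : lead_coef P = 1.
  by rewrite lead_coefDl ?lead_coefXn // size_polyN size_polyX size_polyXn.
rewrite scale1r => PE; split.
- rewrite -separable_prod_XsubC -PE unlock.
  (* The exponent [N] vanishes in [K], so the derivative is a nonzero constant and all roots are
     simple. *)
  have -> : P^`() = - 1.
    rewrite /P derivB derivXn derivX -mulr_natr -polyC_natr /N natrX (card_natr0 iota).
    by rewrite expr0n eqn0Ngt n_gt0 polyC0 mulr0 sub0r.
  by rewrite -scaleN1r coprimepZr ?coprimep1 ?oppr_eq0 ?oner_eq0.
- move=> x; rewrite -root_prod_XsubC -PE /root !hornerE subr_eq0.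
  by rewrite (iter_frobenius sE).
by move: szP; rewrite PE size_prod_XsubC => -[].
Qed.

Lemma subfield_seqs : exists E : nat -> seq K,
  [/\ forall n, uniq (E n),
      forall n x, (0 < n)%N -> (x \in E n) = (iter n s x == x) &
      forall n, (0 < n)%N -> size (E n) = (#|F| ^ n)%N].
Proof.
pose E n := sval (closed_field_poly_normal ('X^(#|F| ^ n) - 'X : {poly K})).
have EP n (n_gt0 : (0 < n)%N) :=
  subfield_roots n_gt0 (svalP (closed_field_poly_normal ('X^(#|F| ^ n) - 'X : {poly K}))).
(* At [n = 0] the polynomial is zero and its list of roots is arbitrary; the empty list keeps [uniq]
   true. *)
exists (fun n => if n is 0 then [::] else E n); split=> -[|n] //.
- by have [] := EP n.+1 isT.
- by move=> x _; have [_ ->] := EP n.+1 isT.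
by move=> _; have [] := EP n.+1 isT.
Qed.
End FiniteSubfields.

(** * The L-function *)

Section LFunction.
Variables (F : finFieldType) (K : closedFieldType) (iota : {rmorphism F -> K}).
Variables (s : {rmorphism K -> K}).
Hypothesis sE : forall x, s x = x ^+ #|F|.
Variables (E : nat -> seq K).
Hypothesis E_uniq : forall n, uniq (E n).
Hypothesis mem_E : forall n x, (0 < n)%N -> (x \in E n) = (iter n s x == x).

(** A left inverse of [iota], needed because [psi] lives on [F] while sums over roots are formed in
    [K]. The default 0 is met only outside the image of [iota], hence at no nonzero element fixed by
    [s]. *)
Definition descend (y : K) : F := odflt 0 [pick c | iota c == y].

Lemma descendK c : descend (iota c) = c.
Proof.
rewrite /descend; case: pickP => [c' /eqP/fmorph_inj //|/(_ c)].
by rewrite eqxx.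
Qed.

Lemma iota_descend y : s y = y -> iota (descend y) = y.
Proof. by move=> /(frobenius_fixed iota sE)[c <-]; rewrite descendK. Qed.

Lemma descendD x y : s x = x -> s y = y -> descend (x + y) = descend x + descend y.
Proof.
move=> /iota_descend {1}<- /iota_descend {1}<-.
by rewrite -rmorphD descendK.
Qed.

Lemma frobenius_poly_descend (G : {poly K}) :
  map_poly s G = G -> exists g, G = map_poly iota g.
Proof.
move=> fixG; exists (map_poly descend G).
apply/polyP => i; rewrite coef_map_id0 ?rmorph0 // coef_map_id0; last first.
  by rewrite -(rmorph0 iota) descendK.
by rewrite iota_descend // -{2}fixG coef_map.
Qed.

Definition poly_roots (G : {poly K}) : seq K := sval (closed_field_poly_normal G).

Lemma poly_rootsP G : G \is monic -> \prod_(r <- poly_roots G) ('X - r%:P) = G.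
Proof.
rewrite /poly_roots; case: closed_field_poly_normal => r /= GE /monicP lcG.
by rewrite [RHS]GE lcG scale1r.
Qed.

Lemma perm_poly_roots t : perm_eq (poly_roots (\prod_(r <- t) ('X - r%:P))) t.
Proof. by apply: prod_XsubC_eq; rewrite poly_rootsP // monic_prod_XsubC. Qed.

Lemma poly_roots_stable G : G \is monic -> map_poly s G = G -> stable_seq s (poly_roots G).
Proof.
move=> monG fixG; apply: prod_XsubC_eq.
by rewrite big_map -map_prod_XsubC poly_rootsP.
Qed.

Definition monics (n : nat) : seq {poly K} :=
  [seq map_poly iota ('X^n + rVpoly v) | v : 'rV[F]_n].

Lemma size_monic_rV n (v : 'rV[F]_n) : size ('X^n + rVpoly v) = n.+1.
Proof. by rewrite size_polyDl size_polyXn // ltnS size_poly. Qed.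

Lemma mem_monics n G :
  (G \in monics n) = [&& G \is monic, size G == n.+1 & map_poly s G == G].
Proof.
apply/mapP/and3P => [[v _ ->]|[monG /eqP szG /eqP fixG]].
  rewrite frobenius_poly_fixed // map_monic size_map_poly size_monic_rV; split=> //.
  by rewrite monicE lead_coefDl ?lead_coefXn // size_polyXn ltnS size_poly.
have [g gE] := frobenius_poly_descend fixG; rewrite gE map_monic size_map_poly in monG szG *.
exists (poly_rV (g - 'X^n)); first by rewrite mem_enum.
rewrite poly_rV_K; first by rewrite addrC subrK.
apply/leq_sizeP => i le_i.
rewrite coefB coefXn; case: eqP => [->|/eqP ne_i].
  by move/monicP: monG; rewrite /lead_coef szG => ->; rewrite subrr.
by rewrite nth_default ?subrr // szG ltn_neqAle eq_sym ne_i.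
Qed.

Lemma monics_uniq n : uniq (monics n).
Proof.
rewrite map_inj_uniq ?enum_uniq // => v w /map_poly_inj/addrI.
exact: (can_inj rVpolyK).
Qed.

Variables (C : comNzRingType) (psi : F -> C).
Hypothesis psi0 : psi 0 = 1.
Hypothesis psiD : forall x y, psi (x + y) = psi x * psi y.
Variable f : {poly F}.
Local Notation fK := (map_poly iota f).

(** For monic [G] fixed by the Frobenius the sum lies in the image of [F]. On such polynomials this
    is a multiplicative function, whose generating series is the L-function. *)
Definition lam (G : {poly K}) : C := psi (descend (\sum_(r <- poly_roots G) fK.[r])).

Lemma lam_prod t : lam (\prod_(r <- t) ('X - r%:P)) = psi (descend (\sum_(r <- t) fK.[r])).
Proof. by rewrite /lam (perm_big _ (perm_poly_roots t)). Qed.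

Lemma sum_stable_fixed t : stable_seq s t -> s (\sum_(r <- t) fK.[r]) = \sum_(r <- t) fK.[r].
Proof.
move=> st; rewrite rmorph_sum -[RHS](perm_big _ st) big_map /=.
by apply: eq_bigr => r _; exact/esym/(horner_iter_frobenius iota sE f 1).
Qed.

Lemma lamM G H : G \is monic -> map_poly s G = G -> H \is monic -> map_poly s H = H ->
  lam (G * H) = lam G * lam H.
Proof.
move=> monG fixG monH fixH; rewrite -(poly_rootsP monG) -(poly_rootsP monH) -big_cat /=.
rewrite !lam_prod big_cat descendD ?psiD //; exact/sum_stable_fixed/poly_roots_stable.
Qed.

Definition lcoef (n : nat) : C := \sum_(G <- monics n) lam G.

(** For [x] in [E n], with [n] positive, the inner sum is the trace down to [F] of the value of [f]
    at [x]. *)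
Definition expsum (n : nat) : C :=
  \sum_(x <- E n) psi (descend (\sum_(i < n) fK.[iter i s x])).

Lemma lcoef0 : lcoef 0 = 1.
Proof.
have monics0 : perm_eq (monics 0) [:: 1].
  apply: uniq_perm => // [|G]; first exact: monics_uniq.
  rewrite mem_monics inE; apply/and3P/eqP => [[monG /eqP szG _]|->].
    have /size1_polyC GE : (size G <= 1)%N by rewrite szG.
    by move/monicP: monG; rewrite GE lead_coefC => ->.
  by rewrite monic1 size_poly1 rmorph1.
rewrite /lcoef (perm_big _ monics0) big_seq1.
have := lam_prod [::]; rewrite !big_nil => ->.
by rewrite -(rmorph0 iota) descendK psi0.
Qed.

Lemma lam_orbit_poly j x : lam (orbit_poly s j x) = psi (descend (\sum_(i < j) fK.[iter i s x])).
Proof.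
rewrite lam_prod; congr (psi (descend _)).
elim: j x => [|j IH] x; first by rewrite big_nil big_ord0.
by rewrite /= big_cons big_ord_recl IH; congr (_ + _); apply: eq_bigr => i _; rewrite -iterSr.
Qed.

Lemma orbit_poly_fixed j x : iter j s x = x -> map_poly s (orbit_poly s j x) = orbit_poly s j x.
Proof.
move=> fix_x; rewrite map_prod_XsubC -(big_map s xpredT (fun y => 'X - y%:P)).
exact: (perm_big _ (stable_traject fix_x)).
Qed.

(* For G monic of degree n over F there are exactly n pairs (j, x) with x in E j
   and orbit_poly s j x dividing G; count the triples (G, j, x) in both ways. *)
Lemma lcoef_recurrence n :
  n%:R * lcoef n = \sum_(i < n) lcoef i * expsum (n - i).
Proof.
transitivity (\sum_(1 <= j < n.+1) lcoef (n - j) * expsum j); last first.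
  rewrite big_add1 /= big_mkord [RHS](reindex_inj rev_ord_inj) /=.
  apply: eq_bigr => i _ ; by rewrite subKn.
transitivity (\sum_(1 <= j < n.+1) \sum_(x <- E j)
  \sum_(G <- monics n | orbit_poly s j x %| G) lam G).
  rewrite mulr_sumr.
  under [RHS]eq_bigr => j _ do under eq_bigr => x _ do rewrite big_mkcond.
  under [RHS]eq_bigr => j _ do rewrite exchange_big /=.
  rewrite [RHS]exchange_big /=; apply: eq_big_seq => G.
  rewrite mem_monics => /and3P[monG /eqP szG /eqP fixG].
  have szr : size (poly_roots G) = n.
    by have := szG; rewrite -{1}(poly_rootsP monG) size_prod_XsubC => -[].
  have := sum_dvdp_orbit_poly E_uniq mem_E (poly_roots_stable monG fixG).
  rewrite szr poly_rootsP // => {1}<-.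
  rewrite natr_sum mulr_suml; apply: eq_bigr => j _.
  rewrite natr_sum mulr_suml; apply: eq_bigr => x _.
  by case: ifP => _; rewrite ?mul1r ?mul0r.
rewrite !big_nat; apply: eq_bigr => j /andP[j_gt0 le_jn].
rewrite mulr_sumr; apply: eq_big_seq => x; rewrite mem_E // => /eqP fix_x.
pose c := orbit_poly s j x.
have monc : c \is monic by rewrite monic_prod_XsubC.
have szc : size c = j.+1 by rewrite size_prod_XsubC size_traject.
have fixc : map_poly s c = c by apply: orbit_poly_fixed.
(* Multiplication by [c] is a bijection from the monic polynomials of degree [n - j] to the monic
   multiples of [c] of degree [n]. *)
have pe : perm_eq [seq G <- monics n | c %| G] [seq c * H | H <- monics (n - j)].
  apply: uniq_perm.
  - exact/filter_uniq/monics_uniq.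
  - rewrite map_inj_uniq ?monics_uniq //; exact/mulfI/monic_neq0.
  move=> G; rewrite mem_filter mem_monics.
  apply/idP/mapP => [/and4P[/dvdpP[H ->]]|[H]].
    rewrite mulrC => monG /eqP szG /eqP fixG; exists H => //.
    have monH : H \is monic by rewrite -(monicMl _ monc).
    rewrite mem_monics monH andTb; apply/andP; split; apply/eqP.
      move: szG; rewrite size_monicM ?monic_neq0 // szc; lia.
    by apply: (mulfI (monic_neq0 monc)); rewrite -{1}fixc -rmorphM.
  rewrite mem_monics => /and3P[monH /eqP szH /eqP fixH] ->.
  rewrite dvdp_mulIl monicMl // monH rmorphM /= fixc fixH eqxx !andbT.
  rewrite size_monicM ?monic_neq0 // szc szH; lia.
rewrite -big_filter (perm_big _ pe) big_map /lcoef mulr_suml.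
apply: eq_big_seq => H; rewrite mem_monics => /and3P[monH _ /eqP fixH].
by rewrite lamM // lam_orbit_poly mulrC.
Qed.


End LFunction.

(** * Vanishing of the high coefficients of the L-function *)

Section LFunctionDegree.
Variables (F : finFieldType) (K : closedFieldType) (iota : {rmorphism F -> K}).
Variables (s : {rmorphism K -> K}).
Hypothesis sE : forall x, s x = x ^+ #|F|.
Variables (C : idomainType) (psi : F -> C).
Hypothesis psiD : forall x y, psi (x + y) = psi x * psi y.
Variables (f : {poly F}) (d : nat).
Hypothesis size_f : size f = d.+1.
Hypothesis d_gt0 : (0 < d)%N.
Local Notation fK := (map_poly iota f).

(** The coefficient of ['X^(k - d)] has index [d] in [eprod]. Changing it leaves the lower power
    sums alone and moves the [d]-th one, which only the leading coefficient of [f] multiplies. *)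
Lemma sum_poly_roots_shift (k : nat) (c : F) (G : {poly K}) : (d <= k)%N ->
  let G' := G + iota c *: 'X^(k - d) in
  G \is monic -> size G = k.+1 -> G' \is monic -> size G' = k.+1 ->
  \sum_(r <- poly_roots G') fK.[r] =
    \sum_(r <- poly_roots G) fK.[r] - iota (d%:R * lead_coef f * c).
Proof.
move=> le_dk G' monG szG monG' szG'.
set rs := poly_roots G; set rs' := poly_roots G'.
have szr : size rs = k.
  by have := szG; rewrite -{1}(poly_rootsP monG) size_prod_XsubC => -[].
have szr' : size rs' = k.
  by have := szG'; rewrite -{1}(poly_rootsP monG') size_prod_XsubC => -[].
have e i : (i <= k)%N -> (eprod rs)`_i = G`_(k - i).
  by move=> le_ik; rewrite -coef_prod_XsubC_eprod szr // poly_rootsP.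
have e' i : (i <= k)%N -> (eprod rs')`_i = G'`_(k - i).
  by move=> le_ik; rewrite -coef_prod_XsubC_eprod szr' // poly_rootsP.
have [||low top] := @psum_newton_perturb _ rs rs' d (iota c) d_gt0.
- move=> i lt_id; have le_ik : (i <= k)%N by rewrite (leq_trans _ le_dk) // ltnW.
  rewrite e ?e' //.
  rewrite coefD coefZ coefXn; case: eqP => [|_]; last by rewrite mulr0 addr0.
  lia.
- by rewrite e ?e' // coefD coefZ coefXn eqxx mulr1.
have trE t : \sum_(r <- t) fK.[r] = \sum_(i < d.+1) fK`_i * psum t i.
  under eq_bigr => r _ do rewrite horner_coef size_map_poly size_f.
  by rewrite exchange_big; apply: eq_bigr => i _; rewrite mulr_sumr.
rewrite !trE !big_ord_recr /= top mulrBr addrA; congr (_ + _ - _).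
  apply: eq_bigr => -[[|i] lt_id] _ /=; last by rewrite low.
  by rewrite /psum !big_const_seq !count_predT szr szr'.
by rewrite coef_map /lead_coef size_f !rmorphM rmorph_nat mulrCA mulrA.
Qed.

(** Shifting one coefficient permutes the monic polynomials of degree [k] and multiplies each [lam]
    by the same value [psi c0], different from 1, so the sum vanishes. *)
Lemma lcoef_high (k : nat) : d%:R != 0 :> F -> (exists c, psi c != 1) ->
  (d <= k)%N -> lcoef iota psi f k = 0.
Proof.
move=> d_neq0 [c0 psi_c0] le_dk.
have lead_neq0 : lead_coef f != 0 by rewrite lead_coef_eq0 -size_poly_eq0 size_f.
(* Chosen so that the sum over the roots changes by exactly [c0]; this is where [d] must be
   invertible in [F]. *)
pose c := - c0 / (d%:R * lead_coef f).
have c0E : c0 = - (d%:R * lead_coef f * c) by rewrite /c; field; rewrite d_neq0 lead_neq0.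
pose shift c (G : {poly K}) := G + iota c *: 'X^(k - d).
have shift_monics a G : G \in monics iota k -> shift a G \in monics iota k.
  rewrite !(mem_monics iota sE) => /and3P[monG /eqP szG /eqP fixG].
  have lt_sz : (size (iota a *: 'X^(k - d) : {poly K}) < size G)%N.
    rewrite szG ltnS (leq_trans (size_scale_leq _ _)) // size_polyXn; lia.
  rewrite size_polyDl // szG eqxx monicE lead_coefDl // -monicE monG.
  by rewrite rmorphD /= map_polyZ map_polyXn fixG frobenius_iota.
have shiftK a : cancel (shift a) (shift (- a)).
  by move=> G; rewrite /shift rmorphN scaleNr addrK.
have pe : perm_eq (monics iota k) (map (shift c) (monics iota k)).
  apply: uniq_perm; first exact: monics_uniq.
    by rewrite (map_inj_uniq (can_inj (shiftK c))) monics_uniq.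
  move=> G; apply/idP/mapP => [GM|[H HM ->]]; last exact: shift_monics.
  exists (shift (- c) G); first exact: shift_monics.
  by have := shiftK (- c) G; rewrite opprK.
have : lcoef iota psi f k = psi c0 * lcoef iota psi f k.
  rewrite {1}/lcoef (perm_big _ pe) big_map mulr_sumr; apply: eq_big_seq => G GM.
  have := GM; have := shift_monics c _ GM; rewrite !(mem_monics iota sE).
  move=> /and3P[monG' /eqP szG' /eqP fixG'] /and3P[monG /eqP szG /eqP fixG].
  rewrite /lam sum_poly_roots_shift // -rmorphN -c0E (descendD iota sE) ?descendK ?psiD 1?mulrC //.
    exact/(sum_stable_fixed iota sE)/poly_roots_stable.
  exact: frobenius_iota.
move/eqP; rewrite -subr_eq0 -{1}[lcoef _ _ _ _]mul1r -mulrBl mulf_eq0 subr_eq0 eq_sym.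
by rewrite (negPf psi_c0) => /eqP.
Qed.
End LFunctionDegree.

(** * Stepanov's method *)

(** Among the terms with nonzero coefficient, the leading term of the largest one cannot be
    cancelled. *)
Lemma lincomb_distinct_sizes_neq0 (F : fieldType) (I : finType) (P : I -> {poly F})
    (c : I -> F) (i0 : I) :
  (forall i, P i != 0) -> injective (fun i => size (P i)) -> c i0 != 0 ->
  \sum_i c i *: P i != 0.
Proof.
move=> P_neq0 sz_inj ci0.
case: (@arg_maxnP _ i0 (fun i => c i != 0) (fun i => size (P i)) ci0) => i ci i_max.
apply: contra_neq (ci) => sum0; have := congr1 (fun p : {poly F} => p`_(size (P i)).-1) sum0.
rewrite coef0 coef_sum (bigD1 i) //= big1 => [|j ne_ji].
  rewrite addr0 coefZ => /eqP; rewrite mulf_eq0 -/(lead_coef _) lead_coef_eq0.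
  by rewrite (negPf (P_neq0 i)) orbF => /eqP.
rewrite coefZ; have [->|cj] := eqVneq (c j) 0; first by rewrite mul0r.
rewrite nth_default ?mulr0 // -ltnS prednK ?size_poly_gt0 // ltn_neqAle.
by rewrite (inj_eq sz_inj) ne_ji; exact: i_max.
Qed.

(** More vectors than the dimension [M]: the matrix of coefficients has a nonzero left kernel. *)
Lemma lincomb_relation (F : fieldType) (I : finType) (P : I -> {poly F}) (M : nat) :
  (forall i, size (P i) <= M)%N -> (M < #|I|)%N ->
  exists2 c : I -> F, exists i, c i != 0 & \sum_i c i *: P i = 0.
Proof.
move=> szP ltM.
pose A : 'M[F]_(#|I|, M) := \matrix_i poly_rV (P (enum_val i)).
have : kermx A != 0.
  by rewrite kermx_eq0 -row_leq_rank -ltnNge (leq_ltn_trans (rank_leq_col A)).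
case/rowV0Pn => v /sub_kermxP vA v_neq0.
exists (fun i => v 0 (enum_rank i)).
  have /existsP[j vj] : [exists j, v 0 j != 0].
    apply: contraNT v_neq0; rewrite negb_exists => /forallP v0.
    by apply/eqP/rowP => j; rewrite mxE; apply/eqP; have := v0 j; rewrite negbK.
  by exists (enum_val j); rewrite enum_valK.
have: rVpoly (v *m A) = 0 by rewrite vA linear0.
rewrite mulmx_sum_row linear_sum /= => E; rewrite -[RHS]E.
rewrite [LHS](reindex (enum_val : 'I_#|I| -> I)) /=; last exact/onW_bij/enum_val_bij.
apply: eq_bigr => j _; rewrite enum_valK rowK linearZ /= poly_rV_K //.
Qed.

(** Separates the degrees in the auxiliary polynomial: [u] is read off modulo [Q'], then [w] modulo
    [q] because [d] is invertible there, and [v] is what remains. *)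
Lemma stepanov_degree_inj (q Q' d u v w u' v' w' : nat) :
  (0 < Q')%N -> coprime d q -> (u < Q')%N -> (u' < Q')%N -> (w < q)%N -> (w' < q)%N ->
  (u + q * Q' * v + d * Q' * w = u' + q * Q' * v' + d * Q' * w')%N ->
  [/\ u = u', v = v' & w = w'].
Proof.
move=> Q'_gt0 co_dq lt_u lt_u' lt_w lt_w' E.
have q_gt0 : (0 < q)%N by case: q lt_w {co_dq lt_w' E}.
have E' : ((q * v + d * w) * Q' + u = (q * v' + d * w') * Q' + u')%N by lia.
have eu : u = u'.
  by have := congr1 (modn^~ Q') E'; rewrite !modnMDl !modn_small.
have ek : (q * v + d * w = q * v' + d * w')%N.
  by move/eqP: E'; rewrite eu eqn_add2r eqn_pmul2r // => /eqP.
have ew : w = w'.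
  have := congr1 (modn^~ q) ek; rewrite ![(q * _)%N]mulnC !modnMDl => /eqP.
  wlog le_w : w w' lt_w lt_w' {E E' ek} / (w' <= w)%N.
    by move=> th; case: (leqP w' w) => [/th|/ltnW/th th' /eqP/esym/eqP]; auto => /th' ->.
  rewrite eqn_mod_dvd ?leq_mul2l ?le_w ?orbT // -mulnBr Gauss_dvdr 1?coprime_sym //.
  move=> dv; apply/eqP; rewrite eqn_leq le_w andbT -subn_eq0; apply: contraTT dv.
  rewrite -lt0n => gt0; rewrite gtnNdvd // ; lia.
split=> //; move/eqP: ek; rewrite ew eqn_add2r eqn_pmul2l // => /eqP //.
Qed.

Section Stepanov.
Variables (F : finFieldType) (K : fieldType) (iota : {rmorphism F -> K}).
Variables (s : {rmorphism K -> K}).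
Hypothesis sE : forall x, s x = x ^+ #|F|.
Variables (f : {poly F}) (d : nat).
Hypothesis size_f : size f = d.+1.
Hypothesis d_gt0 : (0 < d)%N.
Hypothesis coprime_dq : coprime d #|F|.
Local Notation q := #|F|.
Local Notation fK := (map_poly iota f).

Definition trace_poly (a : nat) : {poly F} := \sum_(i < a) f ^+ (q ^ i).

Lemma size_trace_poly a : size (trace_poly a.+1) = (d * q ^ a).+1.
Proof.
have f_neq0 : f != 0 by rewrite -size_poly_eq0 size_f.
have szX i : size (f ^+ (q ^ i)) = (d * q ^ i).+1.
  by rewrite -(@prednK (size (f ^+ _))) ?size_poly_gt0 ?expf_neq0 // size_exp size_f.
rewrite /trace_poly; elim: a => [|a IH]; first by rewrite big_ord1 szX.
rewrite big_ord_recr /= addrC size_polyDl szX // IH ltnS ltn_mul2l d_gt0.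
by rewrite ltn_exp2l ?finNzRing_gt1 /=.
Qed.

Lemma horner_trace_poly a x :
  (map_poly iota (trace_poly a)).[x] = \sum_(i < a) fK.[iter i s x].
Proof.
rewrite rmorph_sum horner_sum; apply: eq_bigr => i _.
rewrite rmorphXn horner_exp horner_iter_frobenius //.
by rewrite (iter_frobenius sE).
Qed.

(* At a counted point x, T = trace_poly a.+1 satisfies T(x)^Q = c0 - T(x), and
   (x^Q)^Q = x.  So the Q-th power of h = sum c_i X^u (X^Q)^v T^w, whose
   coefficients lie in F and are fixed by the Frobenius, takes at x the value of
   sum c_i X^(Q u + v) (c0 - T)^w; the c_i are chosen to kill the latter
   polynomial, while h is nonzero since its terms have distinct degrees. *)
Lemma stepanov_bound (a : nat) (c0 : F) (t : seq K) (n := (a.+1 + a.+1)%N) :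
  (d.+1 < q ^ a)%N -> uniq t ->
  (forall x, x \in t -> iter n s x = x /\ \sum_(i < n) fK.[iter i s x] = iota c0) ->
  (size t <= q ^ a.+1 * q ^ a + (2 * d + 2) * q ^ a.+1)%N.
Proof.
move=> lt_d t_uniq tP; set Q := (q ^ a.+1)%N; set Q' := (q ^ a)%N.
have q_gt1 : (1 < q)%N := finNzRing_gt1 F.
have QE : Q = (q * Q')%N by rewrite /Q expnS.
have Q'_gt0 : (0 < Q')%N by rewrite expn_gt0 (ltnW q_gt1).
(* With this choice there are [Q * Q' + Q + d * Q] unknowns for [Q * Q' + N + d * Q] equations, so
   [N < Q] is all that a nontrivial solution requires. *)
pose N := (Q' + d.+1)%N.
have lt_NQ : (N < Q)%N.
  rewrite (@leq_trans (Q' + Q')) //; first by rewrite /N -addnS leq_add2l.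
  by rewrite addnn -mul2n QE leq_mul2r q_gt1 orbT.
pose T := trace_poly a.+1.
have szT : size T = (d * Q').+1 := size_trace_poly a.
pose I := ('I_Q' * 'I_N * 'I_q)%type.
pose cT := c0%:P - T.
pose P (i : I) := 'X^(Q * i.1.1 + i.1.2) * cT ^+ i.2.
pose H (i : I) := 'X^(i.1.1 + Q * i.1.2) * T ^+ i.2.
have dQE : (d * Q' * q = d * Q)%N by rewrite QE; lia.
have T_neq0 : T != 0 by rewrite -size_poly_eq0 szT.
have szH i : size (H i) = (i.1.1 + q * Q' * i.1.2 + d * Q' * i.2).+1.
  rewrite /H mulrC size_mulXn ?expf_neq0 // QE; apply/eqP.
  by rewrite -(@prednK (size (T ^+ _))) ?size_poly_gt0 ?expf_neq0 // addnS eqSS size_exp szT.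
have [c [i0 ci0] sumP] : exists2 c : I -> F, exists i, c i != 0 & \sum_i c i *: P i = 0.
  apply: (@lincomb_relation _ _ _ (Q * Q' + N + d * Q)%N).
    move=> [[u v] w]; rewrite /P /=.
    rewrite (leq_trans (size_polyMleq _ _)) // size_polyXn /=.
    have szcT : (size cT <= (d * Q').+1)%N.
      rewrite (leq_trans (size_polyD _ _)) // size_polyN szT geq_max leqnn andbT.
      by rewrite (leq_trans (size_polyC_leq1 _)).
    have szw : (size (cT ^+ w)%R <= (d * Q' * w).+1)%N.
      rewrite (leq_trans (size_poly_exp_leq _ _)) // ltnS leq_mul2r; apply/orP; right.
      by rewrite -subn1 leq_subLR add1n.
    have : (Q * u <= Q * Q')%N by rewrite leq_mul2l (ltnW (ltn_ord u)) orbT.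
    have : (d * Q' * w <= d * Q)%N by rewrite -dQE leq_mul2l (ltnW (ltn_ord w)) orbT.
    move: (ltn_ord v) szw; move: (size _) (nat_of_ord v) => z v0; clear; lia.
  rewrite !card_prod !card_ord.
  have -> : (Q' * N * q = Q * Q' + Q + d * Q)%N by rewrite QE /N; lia.
  by rewrite ltn_add2r ltn_add2l.
pose h := \sum_i c i *: H i.
have h_neq0 : h != 0.
  apply: (lincomb_distinct_sizes_neq0 _ _ ci0).
    by move=> i; rewrite -size_poly_eq0 szH.
  move=> [[u v] w] [[u' v'] w'] /=; rewrite !szH /= => -[].
  case/stepanov_degree_inj => // /val_inj -> /val_inj -> /val_inj -> //.
have root_h x : x \in t -> root (map_poly iota h) x.
  move=> /tP[fix_x trx].
  have [sg sgE] : exists sg : {rmorphism K -> K}, forall y, sg y = iter a.+1 s y.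
    elim: (a.+1) => [|b [sg sgE]]; first by exists idfun.
    by exists (s \o sg) => y /=; rewrite sgE.
  set y := (map_poly iota T).[x].
  (* The trace has [n] terms, twice [a.+1]: its first half is [y] and its second half is the image
     of [y] under [sg]. *)
  have sgy : sg y = iota c0 - y.
    rewrite -trx /n big_split_ord /= sgE -horner_iter_frobenius // /y !horner_trace_poly.
    rewrite addrC addrK; apply: eq_bigr => i _; by rewrite -iterD addnC.
  have sgx : sg x = x ^+ Q by rewrite sgE (iter_frobenius sE).
  have xQQ : x ^+ (Q * Q) = x by rewrite -expnD -(iter_frobenius sE).
  have hx : (map_poly iota h).[x] = \sum_i iota (c i) * (x ^+ (i.1.1 + Q * i.1.2) * y ^+ i.2).
    rewrite /h rmorph_sum horner_sum; apply: eq_bigr => j _.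
    by rewrite /= map_polyZ hornerZ rmorphM hornerM !rmorphXn /= map_polyX !horner_exp hornerX.
  rewrite /root hx -(fmorph_eq0 sg) rmorph_sum.
  have := congr1 (fun p => (map_poly iota p).[x]) sumP.
  rewrite rmorph0 horner0 rmorph_sum horner_sum => P0; rewrite -[X in _ == X]P0.
  apply/eqP/eq_bigr => i _.
  rewrite /= map_polyZ hornerZ /P !rmorphM hornerM !rmorphXn /= map_polyX !horner_exp hornerX.
  rewrite rmorphB /= map_polyC hornerD hornerN hornerC -/y sgy sgx.
  congr (_ * (_ * _)); first by rewrite sgE iter_fix // frobenius_iota.
  by rewrite -exprM mulnDr mulnA !exprD (exprM x (Q * Q)) xQQ.
have lt_t : (size t < size h)%N.
  rewrite -(size_map_poly iota); apply: max_poly_roots => //.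
    by rewrite map_poly_eq0.
  by apply/allP.
have szh : (size h <= Q' + Q * N + d * Q)%N.
  rewrite (leq_trans (size_sum _ _ _)) //; apply/bigmax_leqP => -[[u v] w] _.
  rewrite (leq_trans (size_scale_leq _ _)) // szH /=.
  have : (d * Q' * w <= d * Q)%N by rewrite -dQE leq_mul2l (ltnW (ltn_ord w)) orbT.
  have : (q * Q' * v <= Q * N)%N by rewrite QE leq_mul2l (ltnW (ltn_ord v)) orbT.
  by move=> le_v le_w; rewrite -!addSn !leq_add.
rewrite -ltnS (leq_trans (leq_trans lt_t szh)) //.
have -> : (Q' + Q * N + d * Q = Q * Q' + (2 * d + 1) * Q + Q')%N by rewrite /N; lia.
rewrite leqW // -addnA leq_add2l.
have -> : ((2 * d + 2) * Q = (2 * d + 1) * Q + Q)%N by lia.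
by rewrite leq_add2l (leq_trans _ (ltnW lt_NQ)) // leq_addr.
Qed.
End Stepanov.

(** * Weil's bound *)

Section Weil.
Variables (F : finFieldType) (C : numClosedFieldType) (psi : F -> C).
Hypothesis archi : forall x : C, exists n : nat, `|x| <= n%:R.
Hypothesis psi0 : psi 0 = 1.
Hypothesis psiD : forall x y, psi (x + y) = psi x * psi y.
Hypothesis psi_norm : forall x, `|psi x| = 1.
Hypothesis psi_nontrivial : exists c, psi c != 1.
Variables (f : {poly F}) (d : nat).
Hypothesis size_f : size f = d.+1.
Hypothesis d_gt0 : (0 < d)%N.
Hypothesis coprime_dq : coprime d #|F|.

Lemma natr_coprime_neq0 : d%:R != 0 :> F.
Proof.
have [p pchF [k qE]] := card_pchar_pow F.
rewrite -(dvdn_pcharf pchF) -prime_coprime ?(pcharf_prime pchF) //.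
have k_gt0 : (0 < k)%N.
  by case: k qE => // /eqP; rewrite expn0; have := finNzRing_gt1 F; case: #|F| => [|[]].
by move: coprime_dq; rewrite qE coprime_pexpr // coprime_sym.
Qed.

Lemma sum_psi0 : \sum_(x : F) psi x = 0.
Proof.
have [c psi_c] := psi_nontrivial.
have : \sum_x psi x = psi c * \sum_x psi x.
  rewrite mulr_sumr (reindex_inj (addrI c)) /=.
  by apply: eq_bigr => x _; rewrite psiD.
move/eqP; rewrite -subr_eq0 -{1}[\sum_x _]mul1r -mulrBl mulf_eq0 subr_eq0 eq_sym.
by rewrite (negPf psi_c) => /eqP.
Qed.

Variables (K : closedFieldType) (iota : {rmorphism F -> K}).
Variables (s : {rmorphism K -> K}).
Hypothesis sE : forall x, s x = x ^+ #|F|.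
Variables (E : nat -> seq K).
Hypothesis E_uniq : forall n, uniq (E n).
Hypothesis mem_E : forall n x, (0 < n)%N -> (x \in E n) = (iter n s x == x).
Hypothesis size_E : forall n, (0 < n)%N -> size (E n) = (#|F| ^ n)%N.
Local Notation q := #|F|.
Local Notation fK := (map_poly iota f).
Local Notation S := (expsum iota s E psi f).

(** Upper bounds [M] on the fibres of the trace suffice: as [psi] sums to 0, the fibre sizes [N c]
    may be replaced by the nonnegative deficits [M - N c], whose total is [q * M - q ^ n]. There the
    main terms cancel. *)
Lemma expsum_bound (m : nat) : (d.+2 <= m)%N ->
  `|S (m + m)| <= (q * (2 * d + 2))%:R * q%:R ^+ m.
Proof.
case: m => // a le_da; set n := (a.+1 + a.+1)%N.
have lt_d : (d.+1 < q ^ a)%N.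
  by rewrite (leq_trans (ltn_expl _ (finNzRing_gt1 F))) // leq_exp2l ?finNzRing_gt1.
pose tr x := \sum_(i < n) fK.[iter i s x].
pose N c := count (fun x => descend iota (tr x) == c) (E n).
pose M := (q ^ a.+1 * q ^ a + (2 * d + 2) * q ^ a.+1)%N.
have tr_fixed x : x \in E n -> s (tr x) = tr x.
  rewrite mem_E // => /eqP fix_x.
  rewrite /tr rmorph_sum /=.
  have fix_fx : iter n s fK.[x] = fK.[x] by rewrite -horner_iter_frobenius // fix_x.
  under eq_bigr => i _ do rewrite horner_iter_frobenius //.
  under [RHS]eq_bigr => i _ do rewrite horner_iter_frobenius //.
  move: fix_fx; rewrite /n addSn => fix_fx.
  by rewrite [LHS]big_ord_recr [RHS]big_ord_recl /= -[s (iter _ _ _)]/(iter _.+1 s _) fix_fx addrC.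
have le_NM c : (N c <= M)%N.
  rewrite /N -size_filter.
  apply: (stepanov_bound (iota := iota) sE size_f d_gt0 coprime_dq lt_d (c0 := c)).
    exact: filter_uniq.
  move=> x; rewrite mem_filter => /andP[/eqP <- xE]; split.
    by apply/eqP; rewrite -mem_E.
  by rewrite (iota_descend iota sE) // tr_fixed.
have sumN : (\sum_c N c = q ^ n)%N.
  rewrite -size_E // -sum1_size.
  under eq_bigr => c _ do rewrite /N -sum_nat_of_bool.
  rewrite exchange_big /=; apply: eq_bigr => x _.
  by rewrite (bigD1 (descend iota (tr x))) //= eqxx big1 // => c; rewrite eq_sym => /negPf ->.
have SE : S n = \sum_c (N c)%:R * psi c.
  under [RHS]eq_bigr => c _ do rewrite /N -sum_nat_of_bool natr_sum mulr_suml.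
  rewrite exchange_big /=; apply: eq_bigr => x _.
  rewrite (bigD1 (descend iota (tr x))) //= eqxx mul1r [X in _ + X]big1 ?addr0 // => c.
  by rewrite eq_sym => /negPf ->; rewrite mul0r.
have -> : S n = - \sum_c (M - N c)%N%:R * psi c.
  under eq_bigr => c _ do rewrite natrB // mulrBl.
  by rewrite sumrB -mulr_sumr sum_psi0 mulr0 sub0r opprK SE.
rewrite normrN (le_trans (ler_norm_sum _ _ _)) //.
under eq_bigr => c _ do rewrite normrM psi_norm mulr1 normr_nat.
rewrite -natr_sum -natrX -natrM ler_nat sumnB // sumN sum_nat_const cardT -cardE.
rewrite leq_subLR /n expnD /M expnS; move: (q ^ a)%N (q) => Q0 q0; clear; lia.
Qed.

Lemma weil_bound_aux (b : C) : 0 <= b -> b ^+ 2 = q%:R ->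
  `|\sum_(x : F) psi f.[x]| <= d.-1%:R * b.
Proof.
move=> b_ge0 b2.
have S1 : S 1 = \sum_(x : F) psi f.[x].
  have pe : perm_eq (E 1) [seq iota c | c <- enum F].
    apply: uniq_perm => //; first by rewrite map_inj_uniq ?enum_uniq //; exact: fmorph_inj.
    move=> x; rewrite mem_E //; apply/eqP/mapP => [/(frobenius_fixed iota sE)[c <-]|[c _ ->]].
      by exists c; rewrite ?mem_enum.
    exact: frobenius_iota.
  rewrite /expsum (perm_big _ pe) big_map big_enum; apply: eq_bigr => c _.
  by rewrite big_ord1 horner_map descendK.
have [zs szzs SE] := exists_power_sums d_gt0 (lcoef0 iota sE psi0 f)
  (fun k => lcoef_high iota sE psiD size_f d_gt0 natr_coprime_neq0 psi_nontrivial)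
  (lcoef_recurrence iota sE E_uniq mem_E psiD f).
have q_gt0 : 0 < q%:R :> C by rewrite ltr0n (ltn_trans _ (finNzRing_gt1 F)).
have bound w : w \in zs -> `|w| <= b.
  move=> w_zs; rewrite -(@ler_pXn2r _ 2) ?nnegrE // b2 -normrX.
  (* Only even indices are bounded, so the growth lemma is applied to the squares of the roots, with
     [B] equal to the number of elements of [F]. *)
  apply: (@power_sum_growth _ [seq v ^+ 2 | v <- zs] (q * (2 * d + 2))%:R _ d.+2) => //.
    move=> m le_m; have := expsum_bound le_m; rewrite SE ?addn_gt0 ?(leq_trans _ le_m) //.
    rewrite normrN; congr (`|_| <= _); rewrite /psum big_map.
    by apply: eq_bigr => v _; rewrite addnn -mul2n exprM.
  exact: map_f.
rewrite -S1 SE // normrN (le_trans (ler_norm_sum _ _ _)) // -szzs.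
under eq_bigr => v _ do rewrite expr1.
rewrite big_seq (le_trans (ler_sum _ (fun v => bound v))) // -big_seq.
by rewrite big_const_seq count_predT iter_addr_0 mulr_natl.
Qed.
End Weil.

Theorem weil_bound (F : finFieldType) (C : numClosedFieldType) (psi : F -> C)
    (f : {poly F}) (d : nat) (b : C) :
  (forall x : C, exists n : nat, `|x| <= n%:R) ->
  psi 0 = 1 -> (forall x y, psi (x + y) = psi x * psi y) ->
  (forall x, `|psi x| = 1) -> (exists c, psi c != 1) ->
  size f = d.+1 -> (0 < d)%N -> coprime d #|F| ->
  0 <= b -> b ^+ 2 = #|F|%:R ->
  `|\sum_(x : F) psi f.[x]| <= d.-1%:R * b.
Proof.
move=> archi psi0 psiD psi_norm psi_nt szf d_gt0 co_dq b_ge0 b2.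
have [K [iota _]] := countable_algebraic_closure F.
have [s sE] := frobenius_rmorphism iota.
have [E [E_uniq mem_E size_E]] := subfield_seqs iota sE.
exact: (weil_bound_aux archi psi0 psiD psi_norm psi_nt szf d_gt0 co_dq
  iota sE E_uniq mem_E size_E b_ge0 b2).
Qed.

(** * Exponential sums over p-sets *)

Local Open Scope fset_scope.
Local Open Scope complex_scope.
Local Open Scope ring_scope.

(** * Complex exponentials of real phases *)

Section UnitCircle.
Variable R : realType.
Implicit Types t u : R.

Definition expi t : R[i] := cos (2 * pi * t) +i* sin (2 * pi * t).

Lemma cexp_expi t : cexp ((2 * pi * t)%:C * 'i%C) = expi t.
Proof.
by rewrite /cexp /expi; simpc; rewrite /= expR0 !mul1r.
Qed.

Lemma expiD t u : expi (t + u) = expi t * expi u.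
Proof. by rewrite /expi mulrDr cosD sinD; simpc; congr (_ +i* _); ring. Qed.

Lemma expi0 : expi 0 = 1.
Proof. by rewrite /expi mulr0 cos0 sin0. Qed.

Lemma expi_int (z : int) : expi z%:~R = 1.
Proof.
have expi1 : expi 1 = 1 by rewrite /expi mulr1 mulr_natl cos2pi sin2pi.
have expi_nat (n : nat) : expi n%:R = 1.
  by elim: n => [|n IH]; rewrite ?expi0 // -natr1 expiD IH expi1 mulr1.
case: z => n; first exact: expi_nat.
have := expiD (- n.+1%:R) n.+1%:R; rewrite addNr expi0 expi_nat mulr1 => ->.
by rewrite NegzE rmorphN.
Qed.

Lemma expiDz t (z : int) : expi (t + z%:~R) = expi t.
Proof. by rewrite expiD expi_int mulr1. Qed.

Lemma norm_expi t : `|expi t| = 1.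
Proof. by rewrite normc_def /= cos2Dsin2 sqrtr1. Qed.

(** The angle lies strictly between 0 and pi, so the imaginary part is positive. It witnesses that
    the character [expi_Fp] is nontrivial. *)
Lemma expi_inv_neq1 (p : nat) : (2 < p)%N -> expi (p%:R^-1) != 1.
Proof.
move=> p_gt2; rewrite eq_complex /= negb_and; apply/orP; right.
rewrite gt_eqF // sin_gt0_pi //.
have p_gt0 : 0 < p%:R :> R by rewrite ltr0n (ltn_trans _ p_gt2).
rewrite divr_gt0 ?mulr_gt0 ?pi_gt0 //= ltr_pdivrMr // mulrC ltr_pM2l ?pi_gt0 //.
by rewrite ltr_nat.
Qed.

Lemma archi_complex (x : R[i]) : exists n : nat, `|x| <= n%:R.
Proof.
rewrite normc_def; set r := Num.sqrt _.
exists (Num.Def.archi_bound r); rewrite -(rmorph_nat (real_complex R)) lecR.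
by rewrite ltW // archi_boundP // sqrtr_ge0.
Qed.

Lemma natr_complex (n : nat) : (n%:R)%:C = n%:R :> R[i].
Proof. exact: (rmorph_nat (real_complex R)). Qed.

End UnitCircle.

Lemma intr_Fp_neq0 (p : nat) (z : int) : prime p -> z != 0 -> - p%:Z + 1 <= z <= p%:Z - 1 ->
  z%:~R != 0 :> 'F_p.
Proof.
move=> p_prime z_neq0 z_bound; rewrite [z]intEsign rmorphM /= rmorphXn /= rmorphN1.
rewrite mulf_neq0 ?signr_eq0 //.
rewrite -[X in X != _]/(`|z|%N%:R) -(dvdn_pcharf (pchar_Fp p_prime)) gtnNdvd; lia.
Qed.

(** * The additive character of the prime field *)

Section PrimeField.
Variables (R : realType) (p : nat).
Hypothesis p_prime : prime p.

Definition expi_Fp (c : 'F_p) : R[i] := expi ((c : nat)%:R / p%:R).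

Let p_neq0 : p%:R != 0 :> R.
Proof. by rewrite pnatr_eq0 -lt0n prime_gt0. Qed.

Lemma expi_Fp_nat (n : nat) : expi_Fp n%:R = expi (n%:R / p%:R).
Proof.
rewrite /expi_Fp val_Fp_nat // [in RHS](divn_eq n p) natrD natrM mulrDl mulfK // addrC.
by rewrite -[(n %/ p)%:R]/((n %/ p)%:Z%:~R) expiDz.
Qed.

Lemma expi_Fp_int (z : int) : expi_Fp z%:~R = expi (z%:~R / p%:R).
Proof.
case: z => n; first exact: expi_Fp_nat.
(* A natural number congruent to the negative integer modulo [p], which reduces to the case of
   naturals. *)
pose k := (n.+1 * p - n.+1)%N.
have kE : (k + n.+1 = n.+1 * p)%N by rewrite subnK // leq_pmulr // prime_gt0.
have kF : (k%:R : 'F_p) = (Negz n)%:~R.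
  apply/eqP; rewrite NegzE rmorphN /= -addr_eq0 -natrD kE natrM.
  by rewrite (pcharf0 (pchar_Fp p_prime)) mulr0.
rewrite -kF expi_Fp_nat NegzE rmorphN /= -(expiDz (- _ / _) n.+1); congr expi.
have -> : k%:R = n.+1%:R * p%:R - n.+1%:R :> R by rewrite -natrM -kE natrD addrK.
by rewrite mulrBl mulfK // addrC mulNr.
Qed.

Lemma expi_FpD (x y : 'F_p) : expi_Fp (x + y) = expi_Fp x * expi_Fp y.
Proof.
by rewrite -[x]natr_Zp -[y]natr_Zp -natrD !expi_Fp_nat natrD mulrDl expiD.
Qed.

Lemma sum_Fp_ord (G : 'F_p -> R[i]) : \sum_(x : 'F_p) G x = \sum_(j < p) G j%:R.
Proof.
transitivity (\sum_(x : 'F_p) G (x : nat)%:R).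
  by apply: eq_bigr => x _; rewrite natr_Zp.
by rewrite -(big_mkord xpredT (fun j => G j%:R)) -(big_mkord xpredT (fun j => G j%:R)) Fp_cast.
Qed.

End PrimeField.

(** * Exponential sum over a single p-set *)

Section PointSet.
Variables (R : realType) (p d : nat) (a : 'I_d -> nat) (eps : 'I_d.-1 -> bool).
Hypothesis p_prime : prime p.
Hypothesis a_bound : forall i, (1 <= a i <= p - 1)%N.

Let p_neq0 : p%:R != 0 :> R.
Proof. by rewrite pnatr_eq0 -lt0n prime_gt0. Qed.

Lemma a_neq0 i : (a i)%:R != 0 :> 'F_p.
Proof.
have /andP[a_gt0 a_le] := a_bound i.
by rewrite -(dvdn_pcharf (pchar_Fp p_prime)) gtnNdvd //; lia.
Qed.

(** The first coordinate alone determines the index modulo [p], since its coefficient is invertible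
    there. *)
Lemma ppoint_ae_inj : (0 < d)%N -> injective (fun j : 'I_p => ppoint_ae R p a eps j).
Proof.
move=> d_gt0 j j' /rowP/(_ (Ordinal d_gt0)); rewrite !mxE /fracpart => E.
have pexp0 (l : nat) : pexponent a eps l (Ordinal d_gt0) = (a (Ordinal d_gt0) * l)%N.
  by rewrite /pexponent big1 // add0n expn1.
move: E; rewrite !pexp0; set a0 := a _; set x := _ / _; set y := _ / _ => E.
pose z := Num.floor x - Num.floor y.
have xyz : x - y = z%:~R by rewrite /z rmorphB /=; lra.
have {xyz E} /eqP : (a0 * j)%:R - (a0 * j')%:R = z%:~R * p%:R :> R.
  by rewrite -xyz mulrBl !mulfVK.
have pz : p%:R = 0 :> 'F_p := pcharf0 (pchar_Fp p_prime).
rewrite !(pmulrn (1 : R)) -rmorphB -rmorphM eqr_int => /eqP /(congr1 (intmul (1 : 'F_p))).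
rewrite intrB intrM -!pmulrn pz mulr0 => /eqP.
rewrite subr_eq0 !natrM => /eqP.
move/(mulfI (a_neq0 _))/(congr1 (@nat_of_ord _)); rewrite !val_Fp_nat // !modn_small //.
exact: val_inj.
Qed.

Variable k : 'rV[int]_d.

Definition phase_int (j : nat) : int := \sum_(i < d) k 0 i * (pexponent a eps j i)%:Z.

Definition pexponent_poly (i : 'I_d) : {poly 'F_p} :=
  \sum_(h < d.-1 | (h < i)%N) (eps h * a (widen_ord (leq_pred d) h))%:R *: 'X^(h.+1)
  + (a i)%:R *: 'X^(i.+1).

Lemma size_pexponent_poly (i : 'I_d) : size (pexponent_poly i) = i.+2.
Proof.
rewrite /pexponent_poly addrC size_polyDl size_scale ?a_neq0 ?size_polyXn //.
rewrite ltnS (leq_trans (size_sum _ _ _)) //; apply/bigmax_leqP => h lt_hi.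
by rewrite (leq_trans (size_scale_leq _ _)) // size_polyXn.
Qed.

Definition phase_poly : {poly 'F_p} := \sum_(i < d) (k 0 i)%:~R *: pexponent_poly i.

Lemma horner_phase_poly (j : nat) : phase_poly.[j%:R] = (phase_int j)%:~R.
Proof.
rewrite horner_sum rmorph_sum; apply: eq_bigr => i _.
rewrite hornerZ hornerD hornerZ hornerXn horner_sum rmorphM /=; congr (_ * _).
rewrite -[RHS]/((pexponent a eps j i)%:R) natrD natr_sum natrM natrX; congr (_ + _).
by apply: eq_bigr => h _; rewrite hornerZ hornerXn [RHS]natrM natrX.
Qed.

(** Replacing fractional parts by the full quotients changes the phase by the integer [z], which
    [expi] ignores. *)
Lemma expi_dotp (j : nat) :
  expi (dotp k (ppoint_ae R p a eps j)) = expi_Fp R phase_poly.[j%:R].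
Proof.
rewrite horner_phase_poly expi_Fp_int //.
pose z : int := \sum_(i < d) k 0 i * Num.floor ((pexponent a eps j i)%:R / p%:R : R).
rewrite -[LHS](expiDz _ z); congr expi.
rewrite /dotp /phase_int /z !rmorph_sum /= mulr_suml -big_split /=; apply: eq_bigr => i _.
by rewrite mxE /fracpart !rmorphM /=; lra.
Qed.

(** Coordinate [i] contributes degree [i.+1], so the last nonzero entry of [k] fixes the degree. *)
Lemma size_phase_poly (i0 : 'I_d) : (k 0 i0)%:~R != 0 :> 'F_p ->
  (forall i, k 0 i != 0 -> (i <= i0)%N) -> size phase_poly = i0.+2.
Proof.
move=> ki0 i0_max.
rewrite /phase_poly (bigD1 i0) //= size_polyDl size_scale ?size_pexponent_poly //.
rewrite ltnS (leq_trans (size_sum _ _ _)) //; apply/bigmax_leqP => i ne_i.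
have [->|ki] := eqVneq (k 0 i) 0; first by rewrite scale0r size_poly0.
rewrite (leq_trans (size_scale_leq _ _)) // size_pexponent_poly ltnS ltn_neqAle i0_max // andbT.
by rewrite -(inj_eq val_inj) in ne_i.
Qed.

Hypothesis p_odd : odd p.
Hypothesis k_bound : forall i, - p%:Z + 1 <= k 0 i <= p%:Z - 1.
Hypothesis k_neq0 : k != 0.

Lemma sum_pset_bound :
  `|\sum_(x <- pset_ae R p a eps) expi (dotp k x)| <= ((d%:R - 1) * Num.sqrt p%:R)%:C.
Proof.
have [i1 ki1] : exists i, k 0 i != 0.
  apply/existsP; apply: contraNT k_neq0; rewrite negb_exists => /forallP k0.
  by apply/eqP/rowP => i; rewrite mxE; apply/eqP; have := k0 i; rewrite negbK.
have d_gt0 : (0 < d)%N by apply: leq_trans (ltn_ord i1).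
have p_gt2 : (2 < p)%N by rewrite odd_prime_gt2.
case: (@arg_maxnP _ i1 (fun i => k 0 i != 0) (fun i : 'I_d => i : nat) ki1) => i0 ki0 i0_max.
rewrite /pset_ae big_imfset /=; last by move=> j j' _ _; exact: ppoint_ae_inj.
have -> : \sum_(j <- enum_finmem (mem 'I_p)) expi (dotp k (ppoint_ae R p a eps j)) =
    \sum_(x : 'F_p) expi_Fp R phase_poly.[x].
  rewrite sum_Fp_ord // big_enum /=.
  by apply: eq_bigr => j _; rewrite expi_dotp.
have szf := size_phase_poly (intr_Fp_neq0 p_prime ki0 (k_bound i0)) i0_max.
have sqrt_ge0 : 0 <= Num.sqrt p%:R :> R by rewrite sqrtr_ge0.
(* A positive degree below [p] is prime to [p], and Weil's bound applies. Otherwise [p] is at most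
   [d], and the trivial bound [p] is below [(p - 1) sqrt p] because [p] is at least 3. *)
have [lt_p|le_p] := ltnP i0.+1 p.
  have := @weil_bound 'F_p R[i] (expi_Fp R (p := p)) phase_poly i0.+1 (Num.sqrt p%:R)%:C.
  move=> /(_ (@archi_complex R)) weil.
  apply: (le_trans (weil _ (expi_FpD R p_prime) _ _ szf _ _ _ _)) => //.
  - by rewrite /expi_Fp mul0r expi0.
  - by move=> x; exact: norm_expi.
  - by exists 1%:R; rewrite expi_Fp_nat // mul1r expi_inv_neq1.
  - rewrite card_Fp // coprime_sym prime_coprime // gtnNdvd //.
  - by rewrite lecR.
  - by rewrite card_Fp // -rmorphXn /= sqr_sqrtr ?ler0n // natr_complex.
  by rewrite -natr_complex -rmorphM lecR ler_wpM2r //= lerBrDr natr1 ler_nat ltn_ord.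
apply: (le_trans (ler_norm_sum _ _ _)).
under eq_bigr => x _ do rewrite norm_expi.
rewrite sumr_const cardT -cardE card_Fp // -natr_complex lecR.
apply: (@le_trans _ _ ((p%:R - 1) * Num.sqrt p%:R)).
  have r2 : Num.sqrt p%:R ^+ 2 = p%:R :> R by rewrite sqr_sqrtr ?ler0n.
  have p_ge3 : 3 <= p%:R :> R by rewrite ler_nat.
  set r := Num.sqrt _ in r2 sqrt_ge0 *; nra.
rewrite ler_wpM2r // lerB // ler_nat (leq_trans le_p) //.
Qed.

End PointSet.

(** Inclusion-exclusion: the cardinality hypothesis leaves at most one common point, which costs at
    most 1. *)
Lemma norm_sum_fsetU_le (R : realType) (T : choiceType) (A B : {fset T}) (G : T -> R[i]) :
  (forall x, `|G x| = 1) -> (#|` A| + #|` B| <= #|` A `|` B| + 1)%N ->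
  `|\sum_(x <- A `|` B) G x| <= `|\sum_(x <- A) G x| + `|\sum_(x <- B) G x| + 1.
Proof.
move=> normG; rewrite -cardfsUI leq_add2l => card_I.
have -> : \sum_(x <- A `|` B) G x =
    \sum_(x <- A) G x + \sum_(x <- B) G x - \sum_(x <- A `&` B) G x.
  have pU : perm_eq (A `|` B) (A ++ [seq x <- B | x \notin A]).
    apply: uniq_perm; rewrite ?fset_uniq //.
      rewrite cat_uniq fset_uniq filter_uniq ?fset_uniq // andbT /=.
      by apply/hasPn => x; rewrite mem_filter => /andP[].
    by move=> x; rewrite inE mem_cat mem_filter; case: (x \in A).
  have pI : perm_eq (A `&` B) [seq x <- B | x \in A].
    apply: uniq_perm; rewrite ?fset_uniq ?filter_uniq ?fset_uniq //.
    by move=> x; rewrite inE mem_filter.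
  rewrite (perm_big _ pU) (perm_big _ pI) big_cat !big_filter /=.
  by rewrite [X in _ = _ + X - _](bigID (mem A)) /= addrCA [RHS]addrC addKr.
rewrite (le_trans (ler_normB _ _)) // lerD ?ler_normD //.
rewrite (le_trans (ler_norm_sum _ _ _)) //.
under eq_bigr => x _ do rewrite normG.
by rewrite big_const_seq count_predT iter_addr_0 lern1.
Qed.

Theorem theorem2p6 (R : realType) (p q d m : nat)
  (p_prime : prime p) (p_odd : odd p) (q_prime : prime q) (q_odd : odd q)
  (mE : m = (p + q)%N) (d_ge1 : (1 <= d)%N)
  (L : {fset 'rV[R]_d})
  (L_neq : p <> q -> L = classical_pset R d p `|` classical_pset R d q)
  (L_eq : p = q ->
    exists (a b : 'I_d -> nat) (eps1 eps2 : 'I_d.-1 -> bool),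
      [/\ forall i, (1 <= a i <= p - 1)%N,
          forall i, (1 <= b i <= p - 1)%N &
          L = pset_ae R p a eps1 `|` pset_ae R p b eps2])
  (cardL : #|` L| = (p + q - 1)%N)
  (k : 'rV[int]_d)
  (k_p : forall i, - p%:Z + 1 <= k 0 i <= p%:Z - 1)
  (k_q : forall i, - q%:Z + 1 <= k 0 i <= q%:Z - 1)
  (k_neq0 : k != 0) :
  `| \sum_(x <- L) cexp ((2 * pi * dotp k x)%:C * 'i%C) |
    <= ((d%:R - 1) * Num.sqrt (2 * m%:R) + 1)%:C.
Proof.
(* Both cases take a common form, since a classical set has all coefficients 1 and all bits zero. *)
have [a [b [eps1 [eps2 [a_bound b_bound LE]]]]] : exists (a b : 'I_d -> nat)
    (eps1 eps2 : 'I_d.-1 -> bool), [/\ forall i, (1 <= a i <= p - 1)%N,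
      forall i, (1 <= b i <= q - 1)%N & L = pset_ae R p a eps1 `|` pset_ae R q b eps2].
  have [pq|/eqP pq] := eqVneq p q; first by rewrite -pq; exact: L_eq.
  do 2 exists (fun=> 1%N); do 2 exists (fun=> false); split; last exact: L_neq.
    by move=> _; have := prime_gt1 p_prime; lia.
  by move=> _; have := prime_gt1 q_prime; lia.
under eq_bigr => x _ do rewrite cexp_expi.
have card_pset (r : nat) c eps : prime r -> (forall i, (1 <= c i <= r - 1)%N) ->
    (#|` @pset_ae R d r c eps| = r)%N.
  move=> r_prime c_bound; rewrite card_imfset /=; last exact: ppoint_ae_inj.
  by rewrite -cardE card_ord.
have := norm_sum_fsetU_le (A := pset_ae R p a eps1) (B := pset_ae R q b eps2)
  (fun x => norm_expi (dotp k x)).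
rewrite -LE cardL !card_pset // => /(_ _)/le_trans; apply.
  by have := prime_gt1 p_prime; lia.
rewrite rmorphD rmorph1 lerD2r.
have := lerD (sum_pset_bound R eps1 p_prime a_bound p_odd k_p k_neq0)
             (sum_pset_bound R eps2 q_prime b_bound q_odd k_q k_neq0).
move/le_trans; apply.
rewrite -rmorphD lecR -mulrDr ler_wpM2l ?subr_ge0 ?ler1n //.
have p_ge0 : 0 <= p%:R :> R by rewrite ler0n.
have q_ge0 : 0 <= q%:R :> R by rewrite ler0n.
have sp := sqr_sqrtr p_ge0; have sq := sqr_sqrtr q_ge0.
(* Squaring reduces the inequality between the square roots to the nonnegativity of [(x - y) ^+ 2],
   where [x] and [y] are the roots of [p] and [q]. *)
rewrite -(@ler_pXn2r _ 2) ?nnegrE ?addr_ge0 ?sqrtr_ge0 //.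
rewrite mE natrD sqr_sqrtr ?mulr_ge0 ?addr_ge0 //.
move: (Num.sqrt p%:R) (Num.sqrt q%:R) sp sq => x y <- <-.
by rewrite -subr_ge0 (_ : _ - _ = (x - y) ^+ 2) ?sqr_ge0 //; ring.
Qed.
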